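(* Let $p\in[1,\infty)$. There exists a constant $C_{\beta,p}>0$, depending only on $\beta$ and $p$, such that for every $w\in A_p(\mu)$ $$w_\mu(\widetilde R)\le C_{\beta,p}\,[w]_{A_p(\mu)}^2\,w_\mu(R)\qquad\text{for every } R\in\mathcal R.$$
   Context: Tree and flow measure. $T$ is (the vertex set of) an infinite tree, i.e. an infinite connected graph with no loops; it is not assumed to be locally finite. $d$ is the geodesic distance and $x\sim y$ means $d(x,y)=1$. $\partial T$ is the boundary of $T$ (equivalence classes of semi-infinite geodesics, two being equivalent if they eventually coincide). Fix $\omega_*\in\partial T$; $[x,\omega_* )$ is the semi-infinite geodesic from $x$ to $\omega_*$, and $x\le y$ means $y\in[x,\omega_* )$. Fix $o\in T$, enumerate $[o,\omega_* )=\{x_j\}_{j\in\mathbb N}$ with $x_0=o$ and $d(x_j,x_k)=|j-k|$, and define the level $\ell(x)=\lim_{j\to\infty}(j-d(x,x_j))$. The set of successors of $x$ is $s(x)=\{y\sim x:\ell(y)=\ell(x)-1\}$. A flow measure is a positive function $\mu$ on $T$ with $\mu(x)=\sum_{y\in s(x)}\mu(y)$ for all $x\in T$; $\mu(E)=\sum_{y\in E}\mu(y)$. A flow measure $\mu$ is fixed (no doubling assumption). A weight is a positive function on $T$. Trapezoids. Fix a number $\beta\ge 12$. For $x\in T$ and $h_1,h_2\in\mathbb N$, $h_1<h_2$, the trapezoid with root $x$ and heights $h_1,h_2$ is $R_{h_1}^{h_2}(x)=\{y\in T: y\le x,\ h_1\le d(x,y)<h_2\}$. It is admissible if $2\le h_2/h_1\le\beta$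 (so $h_1\ge1$). The envelope of an admissible trapezoid $R=R_{h_1}^{h_2}(x)$ is $\widetilde R=R_{\lceil h_1/\beta\rceil}^{h_2\beta}(x)=\{y\in T:y\le x,\ \lceil h_1/\beta\rceil\le d(x,y)<h_2\beta\}$. $\mathcal R$ is the family of all admissible trapezoids and all singletons; the envelope of a singleton is the singleton itself. Weights. For a weight $w$ and $E\subset T$, $w_\mu(E)=\sum_{y\in E}w(y)\mu(y)$. For $p\in(1,\infty)$, $w\in A_p(\mu)$ means $$[w]_{A_p(\mu)}=\sup_{R\in\mathcal R}\Big(\frac1{\mu(R)}\sum_{y\in R}w(y)\mu(y)\Big)\Big(\frac1{\mu(R)}\sum_{y\in R}w(y)^{-1/(p-1)}\mu(y)\Big)^{p-1}<\infty,$$ and $w\in A_1(\mu)$ means $[w]_{A_1(\mu)}=\sup_{R\in\mathcal R}\frac{w_\mu(R)}{\mu(R)}\|w^{-1}\|_{L^\infty(R)}<\infty$. *)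

(* Defs.v *)
From HB Require Import structures.
From mathcomp Require Import all_boot all_order all_algebra.
From mathcomp Require Import all_classical all_reals all_analysis.

Set Implicit Arguments.
Unset Strict Implicit.
Unset Printing Implicit Defensive.

Import Order.TTheory GRing.Theory Num.Theory.
Import numFieldNormedType.Exports.

Local Open Scope classical_set_scope.
Local Open Scope ring_scope.

Section Tree.
Context {T : choiceType} (e : rel T).

Definition is_tree : Prop :=
  [/\ symmetric e, irreflexive e,
      forall x y, exists2 p, path e x p & last x p = y
    & forall c, ucycle e c -> (size c <= 2)%N].

(* The default value 0 is only used when no walk joins x to y. *)
Definition gdist (x y : T) : nat :=
  xget 0%N [set n | (exists2 p, path e x p & last x p = y /\ size p = n) /\
                    (forall p, path e x p -> last x p = y -> (n <= size p)%N)].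

Definition geodesic_ray (g : nat -> T) : Prop :=
  forall j k : nat, gdist (g j) (g k) = `|j%:Z - k%:Z|%N.

Definition ray_equiv (g h : nat -> T) : Prop :=
  exists m n : nat, forall k : nat, g (m + k)%N = h (n + k)%N.

(* Boundary points are equivalence classes of geodesic rays. *)
Definition boundary : set (set (nat -> T)) :=
  [set omega | exists2 g, geodesic_ray g &
     omega = [set h | geodesic_ray h /\ ray_equiv g h]].

(* [x, omega), enumerated from x; in a tree it is the only ray of the class
   omega issued from x. *)
Definition ray (omega : set (nat -> T)) (x : T) : nat -> T :=
  xget (fun=> x) [set g | omega g /\ g 0%N = x].

Definition tree_le (omega : set (nat -> T)) (x y : T) : Prop :=
  range (ray omega x) y.

End Tree.

Section Flow.
Context {R : realType} {T : choiceType} (e : rel T)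
  (omega : set (nat -> T)) (o : T).

Definition level (x : T) : R :=
  limn (fun j : nat => j%:R - (gdist e x (ray omega o j))%:R : R).

Definition successors (x : T) : set T :=
  [set y | gdist e y x = 1%N /\ level y = level x - 1].

Definition flow_measure (mu : T -> R) : Prop :=
  (forall x, 0 < mu x) /\
  (forall x, (mu x)%:E = \esum_(y in successors x) (mu y)%:E).

End Flow.

Section Trapezoids.
Context {R : realType} {T : choiceType} (e : rel T)
  (omega : set (nat -> T)) (beta : R).

(* The heights are real because the upper height h2 * beta of an envelope need
   not be an integer. *)
Definition trapezoid (x : T) (h1 h2 : R) : set T :=
  [set y | tree_le omega y x /\ h1 <= (gdist e x y)%:R < h2].

Definition admissible (h1 h2 : nat) : Prop :=
  [/\ (0 < h1)%N, (h1 < h2)%N & (2 : R) <= h2%:R / h1%:R <= beta].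

Definition trapezoid_envelope (x : T) (h1 h2 : nat) : set T :=
  trapezoid x (Num.ceil (h1%:R / beta))%:~R (h2%:R * beta).

(* The root and heights of a trapezoid are not determined by its set of points
   (a vertex may have a single successor, and a singleton may also be an
   admissible trapezoid), so the envelope is a relation between sets. *)
Inductive has_envelope : set T -> set T -> Prop :=
| EnvTrapezoid (x : T) (h1 h2 : nat) : admissible h1 h2 ->
    has_envelope (trapezoid x h1%:R h2%:R) (trapezoid_envelope x h1 h2)
| EnvSingleton (x : T) : has_envelope [set x] [set x].

Definition family : set (set T) :=
  [set A | (exists x h1 h2, admissible h1 h2 /\ A = trapezoid x h1%:R h2%:R) \/
           (exists x, A = [set x])].

End Trapezoids.

Section Weights.
Context {R : realType} {T : choiceType} (e : rel T)
  (omega : set (nat -> T)) (beta : R) (mu : T -> R).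

Local Open Scope ereal_scope.

Definition mass (E : set T) : \bar R := \esum_(y in E) (mu y)%:E.

Definition weight (w : T -> R) : Prop := forall x, (0 < w x)%R.

Definition wmass (w : T -> R) (E : set T) : \bar R :=
  \esum_(y in E) (w y * mu y)%:E.

Definition Linfty_norm (E : set T) (f : T -> R) : \bar R :=
  ereal_inf [set M | mass (E `&` [set y | M < `|f y|%:E]) = 0].

(* [w]_{A_p(mu)}; the second branch is meant for 1 < p. *)
Definition Ap_const (p : R) (w : T -> R) : \bar R :=
  if p == 1%R then
    ereal_sup [set wmass w A / mass A * Linfty_norm A (fun y => (w y)^-1%R)
              | A in family e omega beta]
  else
    ereal_sup [set wmass w A / mass A *
                   (wmass (fun y => w y `^ (- (p - 1)^-1))%R A / mass A)
                     `^ (p - 1)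
              | A in family e omega beta].

Definition Ap (p : R) (w : T -> R) : Prop :=
  weight w /\ Ap_const p w < +oo.

End Weights.

(* Main.v *)
Require Import Defs.
From mathcomp Require Import all_boot all_order all_algebra.
From mathcomp Require Import all_classical all_reals all_analysis.
From mathcomp Require Import ring lra zify.
Import Order.TTheory GRing.Theory Num.Theory.
Import numFieldNormedType.Exports.
Local Open Scope classical_set_scope.
Local Open Scope ring_scope.

(** Two facts make the estimate work.

    The first is the usual comparison property of Muckenhoupt weights: if S is
    a subset of a set A of the family and mu(A) <= kap * mu(S), then
    w(A) <= (2 * kap)^p * [w] * w(S) (Ap_comparison). Hoelder's inequality
    would give this without the factor 2^p. Here the elementary bound
    1 <= u + u^(-1/(p-1)) for u > 0, applied to u = t * w(y) and summed over S
    against mu, replaces it: after the right choice of t half of mu(S) is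
    absorbed.

    The second is that mu sees a trapezoid as an interval of heights: the
    vertices at distance n below x carry the total mass mu(x) for every n, by
    the flow equation, so that mu(R_h^k(x)) = (k - h) * mu(x)
    (mass_trapezoid). For this the abstract objects (boundary
    point, rays, level) are reduced to one map: the parent of x is the second
    vertex of [x, omega), the points below x are those with some iterated parent
    equal to x, and the successors of x are exactly its preimages under the
    parent map (successorsE). All of it rests on the uniqueness of simple paths
    in an acyclic graph (simple_path_unique).

    The envelope of R_{h1}^{h2}(x) has heights ranging from ceil(h1 / beta) to
    h2 * beta, a ratio of up to beta^3, too large for a single admissible
    trapezoid. It is covered by R and at most four admissible trapezoids with the
    same root, two reaching above R (when 1 < h1) and two below it:
      - [a, 2 * h1) with a = ceil(2 * h1 / beta), which overlaps R;
      - [c, 4 * c) with c = ceil(h1 / beta), which overlaps the previous one;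
      - [g, 8 * g) with g about h2 / 2, which overlaps R;
      - [2 * h2, ceil(h2 * beta)), which overlaps the previous one.
    Each overlap carries a fixed proportion of the mass, so the comparison
    property is used at most twice in a row, whence the square of [w]. The outer
    trapezoid on the lower side starts at 2 * h2 and not at h2, because
    ceil(h2 * beta) / h2 may exceed beta. *)

(** * Simple paths, distance and geodesic rays in a tree *)

Section TreeGeodesics.
Set Implicit Arguments.
Unset Strict Implicit.
Context {T : choiceType} (e : rel T) (treeT : is_tree e).
Implicit Types (x y : T) (p q : seq T) (g h : nat -> T).

Let e_sym : symmetric e. Proof. by case: treeT. Qed.
Let eirr : irreflexive e. Proof. by case: treeT. Qed.
Let econn x y : exists2 p, path e x p & last x p = y.
Proof. by case: treeT => _ _ + _; exact. Qed.
Let acyclic c : ucycle e c -> (size c <= 2)%N.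
Proof. by case: treeT => _ _ _; exact. Qed.

Lemma simple_loop_nil x p : uniq (x :: p) -> last x p = x -> p = [::].
Proof. by case: p => // a p /= /andP[xNp _] lp; rewrite -lp mem_last in xNp. Qed.

(** If two simple paths with the same ends leave x by different edges, let z be
    the first vertex of the first path that lies on the second one. The two
    initial segments up to z form a cycle with at least three vertices. *)
Lemma simple_path_unique x p q :
  path e x p -> uniq (x :: p) -> path e x q -> uniq (x :: q) ->
  last x p = last x q -> p = q.
Proof.
elim: p x q => [|a p IH] x q.
  by move=> _ _ _ uq lq; rewrite (simple_loop_nil uq (esym lq)).
case: q => [|b q] ep up eq uq lpq; first exact: simple_loop_nil up lpq.
have [ab|ab] := eqVneq a b.
  subst b; congr cons; move: ep up eq uq lpq => /= /andP[_ ep] /andP[_ up].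
  by move=> /andP[_ eq] /andP[_ uq]; exact: IH.
exfalso.
have : has (mem (b :: q)) (a :: p).
  apply/hasP; exists (last a p); first exact: mem_last.
  by move: lpq => /= ->; exact: mem_last.
move=> hpq.
have [z [p1 [p2 [E zq p1Nq]]]] : exists z p1 p2,
    [/\ a :: p = rcons p1 z ++ p2, z \in b :: q & ~~ has (mem (b :: q)) p1].
  by case: (split_find hpq) => z p1 p2 zq ?; exists z, p1, p2.
have [q1 [q2 F]] : exists q1 q2, b :: q = rcons q1 z ++ q2.
  by case/splitPr: zq => q1 q2; exists q1, q2; rewrite cat_rcons.
have {ep} ep1 : path e x (rcons p1 z).
  by move: ep; rewrite E cat_path => /andP[].
have {eq} eq1 : path e x (rcons q1 z).
  by move: eq; rewrite F cat_path => /andP[].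
have {up} up1 : uniq (x :: rcons p1 z).
  by move: up; rewrite E -cat_cons cat_uniq => /andP[].
have {uq} uq1 : uniq (x :: rcons q1 z).
  by move: uq; rewrite F -cat_cons cat_uniq => /andP[].
have cyc : ucycle e (x :: rcons p1 z ++ rev q1).
  apply/andP; split.
    rewrite /= rcons_cat cat_path ep1 last_rcons /= -rev_cons.
    have := eq1; rewrite -rev_path last_rcons belast_rcons.
    by under eq_path do rewrite e_sym.
  rewrite -cat_cons cat_uniq up1 rev_uniq.
  have := uq1; rewrite /= rcons_uniq mem_rcons inE negb_or.
  move=> /andP[/andP[_ xq1] /andP[zq1 uq1']]; rewrite uq1' andbT.
  apply/hasPn => y; rewrite mem_rev => yq1 /=.
  rewrite inE negb_or mem_rcons inE negb_or.
  apply/and3P; split.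
  - by apply: contraNneq xq1 => <-.
  - by apply: contraNneq zq1 => <-.
  - apply/negP => yp1; move/hasPn: p1Nq => /(_ y yp1) /=.
    by rewrite F mem_cat mem_rcons inE yq1 orbT.
(* Size at most 2 forces both segments to be the edge from x to z. *)
have := acyclic cyc; rewrite /= size_cat size_rcons size_rev.
case: p1 q1 E F {p1Nq ep1 eq1 up1 uq1 cyc} => [|? ?] [|? ?] //=.
by move=> [az _] [bz _]; rewrite az bz eqxx in ab.
Qed.

Lemma simple_path_exists x y :
  exists p, [/\ path e x p, uniq (x :: p) & last x p = y].
Proof.
have [p ep <-] := econn x y.
by case: (shortenP ep) => p' ep' up' _; exists p'.
Qed.

Lemma gdist_simple x p :
  path e x p -> uniq (x :: p) -> gdist e x (last x p) = size p.
Proof.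
move=> ep up.
have minp q : path e x q -> last x q = last x p -> (size p <= size q)%N.
  move=> eq; case: (shortenP eq) => q' eq' uq' sub lq.
  rewrite (simple_path_unique ep up eq' uq' (esym lq)).
  by apply: uniq_leq_size => //; move: uq' => /= /andP[].
apply: xget_unique => [|n [[q eq [lq <-]] minq]].
  by split => //; exists p.
by apply/eqP; rewrite eqn_leq minp // minq.
Qed.

Lemma gdistxx x : gdist e x x = 0%N.
Proof. exact: (@gdist_simple x [::]). Qed.

Lemma gdistC x y : gdist e x y = gdist e y x.
Proof.
have [p [ep up <-]] := simple_path_exists x y.
rewrite gdist_simple//.
have ep' : path e (last x p) (rev (belast x p)).
  by rewrite rev_path; under eq_path do rewrite e_sym.
have up' : uniq (last x p :: rev (belast x p)).
  by rewrite -rev_rcons -lastI rev_uniq.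
have := gdist_simple ep' up'; rewrite size_rev size_belast => <-.
by case: p {ep up ep' up'} => //= a p; rewrite rev_cons last_rcons.
Qed.

Lemma gdist1 x y : (gdist e x y == 1%N) = e x y.
Proof.
have [p [ep up <-]] := simple_path_exists x y.
rewrite gdist_simple//; apply/eqP/idP.
  by case: p ep up => [|a []] //= /andP[].
move=> exy; apply/(@congr1 _ _ size p [:: last x p]).
apply: (simple_path_unique ep up) => //=; first by rewrite exy.
by rewrite inE andbT; apply: contraTneq exy => {1}->; rewrite eirr.
Qed.

(** A local description of geodesic rays (see geodesic_rayP) that is stable under
    removing or adding a first vertex. *)
Definition edge_ray (g : nat -> T) := (forall i, e (g i) (g i.+1)) /\ injective g.

Definition segment (g : nat -> T) j n := [seq g i | i <- iota j.+1 n].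

Lemma last_segment g j n : last (g j) (segment g j n) = g (j + n)%N.
Proof.
rewrite /segment last_map; case: n => [|n]; first by rewrite addn0.
by rewrite -nth_last size_iota nth_iota//= addSnnS.
Qed.

Lemma segment_path g j n : (forall i, e (g i) (g i.+1)) ->
  path e (g j) (segment g j n).
Proof. by move=> eg; elim: n j => //= n IH j; rewrite eg IH. Qed.

Lemma segment_uniq g j n : injective g -> uniq (g j :: segment g j n).
Proof. by move=> ig; rewrite -map_cons map_inj_uniq// (iota_uniq _ n.+1). Qed.

Lemma size_segment g j n : size (segment g j n) = n.
Proof. by rewrite size_map size_iota. Qed.

Lemma gdist_ray g j n : edge_ray g -> gdist e (g j) (g (j + n)%N) = n.
Proof.
move=> [eg ig]; rewrite -last_segment gdist_simple ?size_segment//.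
  exact: segment_path.
exact: segment_uniq.
Qed.

Lemma geodesic_rayP g : geodesic_ray e g <-> edge_ray g.
Proof.
split=> [gg|eg].
  split=> [i|j k gjk].
    by rewrite -gdist1 gg; lia.
  by have := gg j k; rewrite gjk gdistxx; lia.
move=> j k; have [jk|kj] := leqP j k.
  by rewrite -(subnKC jk) gdist_ray//; lia.
by rewrite gdistC -(subnKC (ltnW kj)) gdist_ray//; lia.
Qed.

Lemma edge_ray_shift g m : edge_ray g -> edge_ray (fun k => g (m + k)%N).
Proof.
move=> [eg ig]; split=> [i|i j /ig /addnI//]; rewrite addnS; exact: eg.
Qed.

Definition cons_ray x (g : nat -> T) i := if i is i'.+1 then g i' else x.

(** Not turning back at the first step is enough: if x were some g k with
    2 <= k, then g 0, ..., g k would be a cycle. *)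
Lemma edge_ray_cons x g :
  edge_ray g -> e x (g 0%N) -> x != g 1%N -> edge_ray (cons_ray x g).
Proof.
move=> [eg ig] ex x1.
have xN k : x <> g k.
  move=> xg.
  have : (size (g 0%N :: segment g 0 k) <= 2)%N.
    apply: acyclic; apply/andP; split; last exact: segment_uniq.
    rewrite /= rcons_path segment_path// last_segment add0n -xg.
    exact: ex.
  rewrite /= size_segment; case: k xg => [xg|[xg|//]].
    by move: ex; rewrite xg eirr.
  by move: x1; rewrite xg eqxx.
split=> [[|i]//=|[|i] [|j]//=]; first by move/xN.
- by move/esym/xN.
- by move/ig ->.
Qed.

(** Up to any point of the common tail the two rays are simple paths with the
    same ends. *)
Lemma edge_ray_unique g h : edge_ray g -> edge_ray h -> ray_equiv g h ->
  g 0%N = h 0%N -> g = h.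
Proof.
move=> gr hr [m [n gh]] g0.
have seg k : segment g 0 (m + k) = segment h 0 (n + k).
  apply: (@simple_path_unique (g 0%N)).
  - exact: segment_path gr.1.
  - exact: segment_uniq gr.2.
  - by rewrite g0; exact: segment_path hr.1.
  - by rewrite g0; exact: segment_uniq hr.2.
  - by rewrite last_segment g0 last_segment !add0n gh.
apply/funext => -[//|i].
have := congr1 (nth (g 0%N) ^~ i) (seg i.+1).
have := congr1 size (seg 0%N); rewrite !size_segment !addn0 => ->.
have lt k : (i < k + i.+1)%N by lia.
rewrite /segment !(nth_map 0%N) ?size_iota ?lt// !nth_iota//.
Qed.

End TreeGeodesics.

(** * The parent map and the successors *)

Section RaysToTheBoundaryPoint.
Set Implicit Arguments.
Unset Strict Implicit.
Context {T : choiceType} (e : rel T) (treeT : is_tree e).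
Context (omega : set (nat -> T)) (bomega : boundary e omega).
Implicit Types (x y : T) (g h : nat -> T).

Let e_sym : symmetric e. Proof. by case: treeT. Qed.

Lemma omega_edge_ray g : omega g -> edge_ray e g.
Proof.
by case: bomega => g0 _ -> [gg _]; apply/(geodesic_rayP treeT).
Qed.

Lemma omega_equiv g h : omega g -> omega h -> ray_equiv g h.
Proof.
case: bomega => g0 _ -> [_ [m [n gm]]] [_ [m' [n' hm]]].
exists (n + m')%N, (n' + m)%N => k.
by rewrite -!addnA -gm -hm addnCA.
Qed.

Lemma omega_tail g h : omega g -> edge_ray e h ->
  (forall k, g k.+1 = h k) \/ (forall k, h k.+1 = g k) -> omega h.
Proof.
case: bomega => g0 _ -> [gg [m [n gm]]] hr gh.
split; first exact/(geodesic_rayP treeT).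
case: gh => gh.
  by exists m.+1, n => k; rewrite addSnnS gm addnS gh.
by exists m, n.+1 => k; rewrite addSn gh.
Qed.

Lemma omega_shift g : omega g -> omega (fun k => g k.+1).
Proof.
move=> og; apply: (omega_tail og); last by left.
exact: (edge_ray_shift 1 (omega_edge_ray og)).
Qed.

Lemma omega_cons x g :
  omega g -> e x (g 0%N) -> x != g 1%N -> omega (cons_ray x g).
Proof.
move=> og exg xg1; apply: (omega_tail og); last by right.
exact: (edge_ray_cons treeT (omega_edge_ray og)).
Qed.

(** Along an edge from x to y a ray can be moved: either it starts with this
    edge, which is removed, or y is put in front of it. *)
Lemma omega_neighbor x y g : omega g -> g 0%N = x -> e x y ->
  exists2 h, omega h & h 0%N = y.
Proof.
move=> og <- exy; have [yg|yg] := eqVneq y (g 1%N).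
  by exists (fun k => g k.+1); [exact: omega_shift|].
by exists (cons_ray y g) => //; apply: omega_cons; rewrite // e_sym.
Qed.

Lemma omega_from x : exists2 g, omega g & g 0%N = x.
Proof.
have [g0 og0] : exists g, omega g.
  case: bomega => g gg oE; exists g; rewrite oE; split => //.
  by exists 0%N, 0%N.
have [p ep <-] : exists2 p, path e (g0 0%N) p & last (g0 0%N) p = x.
  by case: treeT => _ _ + _; exact.
have : exists2 g, omega g & g 0%N = g0 0%N by exists g0.
elim: p (g0 0%N) ep => //= a p IH y /andP[eya ep] [g og gy].
by apply: IH => //; apply: omega_neighbor og gy eya.
Qed.

Lemma ray_omega x : omega (ray omega x) /\ ray omega x 0%N = x.
Proof.
by apply: (@xgetPex _ _ [set g | omega g /\ g 0%N = x]);
  have [g og gx] := omega_from x; exists g.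
Qed.

Lemma ray_unique x g : omega g -> g 0%N = x -> ray omega x = g.
Proof.
have [orx rx] := ray_omega x; move=> og gx.
apply: (edge_ray_unique treeT).
- exact: omega_edge_ray.
- exact: omega_edge_ray.
- exact: omega_equiv.
- by rewrite rx gx.
Qed.

(** The second vertex of [x, omega); its iterates enumerate [x, omega)
    (ray_iter), so the order of the tree is that of the orbits of this map. *)
Definition parent x := ray omega x 1%N.

Lemma ray_parent x k : ray omega (parent x) k = ray omega x k.+1.
Proof.
rewrite (@ray_unique _ (fun k => ray omega x k.+1))//.
by apply: omega_shift; exact: (ray_omega x).1.
Qed.

Lemma ray_iter x n : ray omega x n = iter n parent x.
Proof.
elim: n x => [|n IH] x; first exact: (ray_omega x).2.
by rewrite iterSr -IH ray_parent.
Qed.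

Lemma gdist_iter_parent x n : gdist e x (iter n parent x) = n.
Proof.
rewrite -ray_iter -[X in gdist _ X _](ray_omega x).2.
exact: (gdist_ray treeT 0 n (omega_edge_ray (ray_omega x).1)).
Qed.

Lemma edge_parent x y : e x y -> parent x = y \/ parent y = x.
Proof.
move=> exy; have [orx rx] := ray_omega x.
have [px|px] := eqVneq (parent x) y; [by left | right].
rewrite /parent (@ray_unique _ (cons_ray y (ray omega x)))//.
by apply: omega_cons => //; [rewrite rx e_sym | rewrite eq_sym].
Qed.

Lemma parent_edge x : e x (parent x).
Proof.
have [orx rx] := ray_omega x.
by have := (omega_edge_ray orx).1 0%N; rewrite rx.
Qed.

Lemma tree_le_gdistP x y n :
  (tree_le omega y x /\ gdist e x y = n) <-> iter n parent y = x.
Proof.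
split=> [[[k _ <-]]|<-].
  by rewrite ray_iter gdistC// gdist_iter_parent => ->.
by split; [exists n => //; exact: ray_iter | rewrite gdistC// gdist_iter_parent].
Qed.

Context {R : realType} (o : T).
Notation lev := (@level R T e omega o).

(** The sequence whose limit is the level is constant once the two rays have
    merged. *)
Lemma level_merge x m n :
  (forall k, ray omega x (m + k) = ray omega o (n + k)) ->
  lev x = n%:R - m%:R.
Proof.
move=> mrg; apply/cvg_lim => //; apply: cvg_near_cst.
exists n => // j /= nj.
rewrite -{2}(subnKC nj) -mrg ray_iter gdist_iter_parent.
by rewrite -{1}(subnKC nj) !natrD opprD addrACA subrr addr0.
Qed.

Lemma level_parent x : lev (parent x) = lev x + 1.
Proof.
have [m [n mrg]] := omega_equiv (ray_omega x).1 (ray_omega o).1.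
rewrite (level_merge mrg) (@level_merge (parent x) m n.+1).
  by rewrite -natr1 addrAC.
by move=> k; rewrite ray_parent -addnS mrg addnS addSn.
Qed.

(** One end of an edge is the parent of the other, and passing to the parent
    raises the level by 1, so the level tells which case holds. *)
Lemma successorsE x : @successors R T e omega o x = [set y | parent y = x].
Proof.
apply/seteqP; split=> y /=.
  move=> [/eqP]; rewrite gdist1// => /edge_parent[//|<-].
  by rewrite level_parent => lx; exfalso; lra.
move=> <-; split; first by apply/eqP; rewrite gdist1// parent_edge.
by rewrite level_parent addrK.
Qed.

End RaysToTheBoundaryPoint.

(** * Sums of nonnegative families *)

Section SumsOfNonnegativeTerms.
Set Implicit Arguments.
Unset Strict Implicit.
Context {R : realType} {T : choiceType}.
Implicit Types (A B : set T) (a : T -> \bar R).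
Local Open Scope ereal_scope.

Lemma esum_subset A B a : A `<=` B -> (forall i, B i -> 0 <= a i) ->
  \esum_(i in A) a i <= \esum_(i in B) a i.
Proof.
move=> AB a0; rewrite (@esumID _ _ A B)// (setIidr AB) leeDl//.
by apply: esum_ge0 => i [/a0].
Qed.

Lemma esum_gt0 A a x : A x -> 0 < a x -> 0 < \esum_(i in A) a i.
Proof.
move=> Ax ax; apply: (lt_le_trans ax); apply: esum_ge.
by exists [set x]; [split=> // y ->|rewrite fsbig_set1].
Qed.

Lemma esum_scale_le A a (c : R) : (0 < c)%R -> (forall i, 0 <= a i) ->
  \esum_(i in A) (c%:E * a i) <= c%:E * \esum_(i in A) a i.
Proof.
move=> c0 a0; apply: ge_ereal_sup => _ [X [fX XA] <-].
rewrite -ge0_mule_fsumr// lee_pmul2l ?lte_fin//.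
by apply: esum_ge; exists X.
Qed.

Lemma esumU_le A B a : (forall i, (A `|` B) i -> 0 <= a i) ->
  \esum_(i in A `|` B) a i <= \esum_(i in A) a i + \esum_(i in B) a i.
Proof.
move=> a0; rewrite (@esumID _ _ A (A `|` B))//; apply: leeD.
  by apply: esum_subset => [i []//|i Ai]; apply: a0; left.
by apply: esum_subset => [i [[]//]|i Bi]; apply: a0; right.
Qed.

Lemma esum_disjoint_bigcup (I : choiceType) (K : set I) (J : I -> set T) a :
  trivIset setT J -> (forall x, 0 <= a x) ->
  \esum_(x in \bigcup_(i in K) J i) a x =
  \esum_(i in K) \esum_(x in J i) a x.
Proof.
move=> tJ a0; rewrite esum_esum//; apply: reindex_esum => //; split.
- by move=> [i x] [/= Ki Jix]; exists i.
- move=> [i x] [j y]; rewrite !inE/= => -[_ Jx] [_ Jy] xy.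
  by congr pair => //; apply: tJ => //; exists x; split=> //; rewrite xy.
- by move=> x [i Ki Jix]; exists (i, x).
Qed.

End SumsOfNonnegativeTerms.

(** * Comparison property of Muckenhoupt weights *)

Section WeightComparison.
Set Implicit Arguments.
Unset Strict Implicit.
Context {R : realType}.

(** The choice of t in the proof of the comparison property: here m and n are
    the masses of A and S, W and s their w-masses, V is the w^(-1/(p-1))-mass of
    A, and t = (2 * V / n)^(p-1) makes the second term equal to n / 2. *)
Lemma Ap_real_bound (p k m n W V s kap : R) :
  1 < p -> 0 < m -> 0 < n -> 0 < W -> 0 < V -> m <= kap * n ->
  W / m * (V / m) `^ (p - 1) <= k ->
  (forall t, 0 < t -> n <= t * s + t `^ (- (p - 1)^-1) * V) ->
  W <= (2 * kap) `^ p * k * s.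
Proof.
move=> p1 m0 n0 W0 V0 mn kW ns.
have q0 : 0 < p - 1 by lra.
(* t = D * B, where W * B is controlled by k * m and D by a power of kap. *)
set B := (V / m) `^ (p - 1) in kW.
have B0 : 0 < B by rewrite powR_gt0 ?divr_gt0.
pose D := (2 * m / n) `^ (p - 1).
have D0 : 0 < D by rewrite powR_gt0// divr_gt0// mulr_gt0.
have tE : (2 * V / n) `^ (p - 1) = D * B.
  rewrite -powRM; [congr (_ `^ _); field; lra|..].
    by rewrite divr_ge0 ?mulr_ge0// ltW.
  by rewrite divr_ge0// ltW.
have := ns _ (mulr_gt0 D0 B0).
rewrite -[in X in _ + X]tE -powRrM mulrN divff ?lt0r_neq0// powR_inv1; last first.
  by rewrite divr_ge0 ?mulr_ge0// ltW.
have -> : (2 * V / n)^-1 * V = n / 2 by field; lra.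
move=> nDB; have {}nDB : n / 2 <= D * B * s by lra.
have s0 : 0 < s.
  by rewrite -(pmulr_rgt0 _ (mulr_gt0 D0 B0)); apply: lt_le_trans nDB; lra.
have k0 : 0 < k by apply: lt_le_trans kW; rewrite mulr_gt0// divr_gt0.
have kap0 : 0 < kap by rewrite -(pmulr_lgt0 _ n0); apply: lt_le_trans mn.
have DE : 2 * m / n * D <= (2 * kap) `^ p.
  have -> : 2 * m / n * D = (2 * m / n) `^ p.
    rewrite -[in LHS](@powRr1 _ (2 * m / n)) ?divr_ge0 ?mulr_ge0 ?ltW//.
    rewrite -powRD; first by congr (_ `^ _); lra.
    by apply/implyP => _; rewrite lt0r_neq0// divr_gt0// mulr_gt0.
  apply: ge0_ler_powR; rewrite ?nnegrE; first lra.
  - by rewrite divr_ge0 ?mulr_ge0 ?ltW.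
  - by rewrite mulr_ge0 ?ltW.
  - by rewrite ler_pdivrMr// -mulrA ler_pM2l.
apply: (@le_trans _ _ (2 * m / n * D * (k * s))); last first.
  by rewrite -[leRHS]mulrA ler_wpM2r// mulr_ge0// ltW.
have -> : 2 * m / n * D * (k * s) = 2 * m / n * D * s * k by ring.
apply: (@le_trans _ _ (2 * m / n * D * s * (W / m * B))); last first.
  by rewrite ler_wpM2l// !mulr_ge0 ?invr_ge0 ?ltW.
have -> : 2 * m / n * D * s * (W / m * B) = W * ((n / 2)^-1 * (D * B * s)).
  by field; lra.
by apply: ler_peMr; [exact: ltW | rewrite ler_pdivlMl ?mulr1//; lra].
Qed.

(** One of u and u^(-q) is at least 1. *)
Lemma powR_add_inverse_ge1 (q u : R) : 0 < q -> 0 < u -> 1 <= u + u `^ (- q).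
Proof.
move=> q0 u0; have [u1|/ltW u1] := leP 1 u.
  by rewrite ler_wpDr// powR_ge0.
apply: ler_wpDl; first exact: ltW.
rewrite powRN invf_ge1 ?powR_gt0//.
have := @ge0_ler_powR R q (ltW q0) u 1; rewrite powR1 !nnegrE.
by apply => //; exact: ltW.
Qed.

Context {T : choiceType} (e : rel T) (omega : set (nat -> T)) (beta : R).
Context (mu w : T -> R).
Hypotheses (mu_gt0 : forall x, 0 < mu x) (w_gt0 : forall x, 0 < w x).
Local Open Scope ereal_scope.

Lemma pos_mule_lty (a b : \bar R) : 0 < a -> 0 < b -> a * b < +oo ->
  a < +oo /\ b < +oo.
Proof.
move: a b => [a| |] [b| |]//=; rewrite ?ltry//.
- by move=> a0 _; rewrite gt0_muley.
- by move=> _ b0; rewrite gt0_mulye.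
Qed.

Lemma pos_finE (a : \bar R) : 0 < a -> a < +oo -> exists2 r : R, (0 < r)%R & a = r%:E.
Proof. by case: a => [r||]//; rewrite lte_fin => r0 _; exists r. Qed.

(** No point is negligible, because mu is positive everywhere. *)
Lemma inv_le_Linfty A y : A y ->
  ((w y)^-1)%:E <= Linfty_norm mu A (fun y => (w y)^-1%R).
Proof.
move=> Ay; apply: le_ereal_inf_tmp => M /= M0; rewrite leNgt; apply/negP => My.
suff : 0 < mass mu (A `&` [set y | M < `|(w y)^-1|%:E]) by rewrite M0 ltxx.
apply: (@esum_gt0 _ _ _ _ y); last by rewrite lte_fin.
by split=> //=; rewrite ger0_norm// invr_ge0 ltW.
Qed.

(** For p = 1 the definition of [w] reads w(A) / mu(A) <= [w] * w(y) for y in A,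
    which is summed over y in S. For 1 < p the bound
    1 <= t * w(y) + (t * w(y))^(-1/(p-1)) is summed over y in S, the second term
    is enlarged to a sum over A, and Ap_real_bound chooses t. Finiteness of [w]
    makes w(A) and the w^(-1/(p-1))-mass of A finite. *)
Lemma Ap_comparison (p kap : R) (A S : set T) :
  (1 <= p)%R -> Ap_const e omega beta mu p w < +oo ->
  Defs.family e omega beta A -> S `<=` A -> mass mu A < +oo -> 0 < mass mu A ->
  mass mu A <= kap%:E * mass mu S ->
  wmass mu w A <=
    ((2 * kap) `^ p)%:E * Ap_const e omega beta mu p w * wmass mu w S.
Proof.
move=> p1 + famA SA mAy mA0 mAS.
set K := Ap_const _ _ _ _ _ _ => Ky.
have wmu0 y : (0 < w y * mu y)%R by rewrite mulr_gt0.
have [m m0 mE] := pos_finE mA0 mAy.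
have mS_ge0 : 0 <= mass mu S by apply: esum_ge0 => *; rewrite lee_fin ltW.
have mSA : mass mu S <= mass mu A by apply: esum_subset => // *; rewrite lee_fin ltW.
have mSfin : mass mu S \is a fin_num.
  by rewrite ge0_fin_numE// (le_lt_trans mSA).
have [n nE] : exists n, mass mu S = n%:E by exists (fine (mass mu S)); rewrite fineK.
rewrite mE nE -EFinM lee_fin in mAS.
have n_gt0 : (0 < n)%R.
  rewrite nE lee_fin in mS_ge0; rewrite lt_neqAle mS_ge0 andbT.
  by apply: contraTneq mAS => <-; rewrite mulr0 -ltNge.
have [x Sx] : exists x, S x.
  apply/set0P; apply: contra_ltN n_gt0 => /eqP S0.
  by rewrite -lee_fin -nE /mass S0 esum_set0.
have Ax := SA _ Sx.
have W0 : 0 < wmass mu w A by apply: (@esum_gt0 _ _ _ _ x); rewrite ?lte_fin.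
have wSA : wmass mu w S <= wmass mu w A.
  by apply: esum_subset => // *; rewrite lee_fin ltW.
have wS0 : 0 < wmass mu w S by apply: (@esum_gt0 _ _ _ _ x); rewrite ?lte_fin.
have minv : (m%:E^-1 = (m^-1)%:E :> \bar R)%E by rewrite inver gt_eqF.
have [p1E|p_neq1] := eqVneq p 1%R.
  have KA : wmass mu w A / mass mu A * Linfty_norm mu A (fun y => (w y)^-1%R) <= K.
    by rewrite /K /Ap_const p1E eqxx; apply: ereal_sup_ubound; exists A.
  have Wm0 : 0 < wmass mu w A / mass mu A by rewrite mE minv mule_gt0// lte_fin invr_gt0.
  have Kw y : A y -> wmass mu w A / mass mu A * ((w y)^-1)%:E <= K.
    by move=> Ay; apply: le_trans KA; rewrite lee_wpmul2l ?inv_le_Linfty// ltW.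
  have [Wmy _] : wmass mu w A / mass mu A < +oo /\ ((w x)^-1)%:E < +oo.
    apply: pos_mule_lty => //; first by rewrite lte_fin invr_gt0.
    exact: le_lt_trans (Kw _ Ax) Ky.
  have [Wy _] : wmass mu w A < +oo /\ (m^-1)%:E < +oo.
    by apply: pos_mule_lty => //; rewrite ?lte_fin ?invr_gt0// -minv -mE.
  have K0 : 0 < K.
    apply: lt_le_trans (Kw _ Ax); rewrite mule_gt0// lte_fin invr_gt0//.
  have [W W_gt0 WE] := pos_finE W0 Wy.
  have [k k0 kE] := pos_finE K0 Ky.
  have [s s0 sE] := pos_finE wS0 (le_lt_trans wSA Wy).
  have Kw' y : A y -> (mu y <= k * m / W * (w y * mu y))%R.
    move=> /Kw; rewrite WE mE minv kE -!EFinM lee_fin => h.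
    rewrite mulrA ler_peMl// ?(ltW (mu_gt0 _))//.
    move: h; rewrite ler_pdivrMr// ler_pdivrMr// => h.
    by rewrite mulrAC ler_pdivlMr// mul1r mulrAC.
  have : mass mu S <= (k * m / W)%:E * wmass mu w S.
    apply: le_trans (esum_scale_le _ _ _).
    - by apply: le_esum => y Sy; rewrite -EFinM lee_fin; apply/Kw'/SA.
    - by rewrite divr_gt0// mulr_gt0.
    - by move=> y; rewrite lee_fin ltW.
  rewrite nE sE WE kE p1E -!EFinM !lee_fin powRr1; last first.
    by rewrite mulr_ge0// -(pmulr_lge0 _ n_gt0); apply: le_trans mAS; exact: ltW.
  rewrite mulrAC ler_pdivlMr// => nW.
  rewrite -(ler_pM2l n_gt0); apply: (le_trans nW).
  have -> : (k * m * s = m * (k * s))%R by ring.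
  have -> : (n * (2 * kap * k * s) = 2 * (kap * n) * (k * s))%R by ring.
  by rewrite ler_pM2r ?mulr_gt0//; lra.
have {p_neq1}p1 : (1 < p)%R by rewrite lt_neqAle eq_sym p_neq1.
set v := fun y => (w y `^ (- (p - 1)^-1))%R.
have v_gt0 y : (0 < v y)%R by rewrite powR_gt0.
have vmu0 y : (0 < v y * mu y)%R by rewrite mulr_gt0.
have V0 : 0 < wmass mu v A by apply: (@esum_gt0 _ _ _ _ x); rewrite ?lte_fin.
have KA : wmass mu w A / mass mu A * (wmass mu v A / mass mu A) `^ (p - 1) <= K.
  rewrite /K /Ap_const (gt_eqF p1); apply: ereal_sup_ubound.
  by exists A.
have Wm0 : 0 < wmass mu w A / mass mu A by rewrite mE minv mule_gt0// lte_fin invr_gt0.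
have Vm0 : 0 < wmass mu v A / mass mu A by rewrite mE minv mule_gt0// lte_fin invr_gt0.
have [Wmy Vmpy] := pos_mule_lty Wm0 (poweR_gt0 (p - 1)%R Vm0) (le_lt_trans KA Ky).
have Vmy : wmass mu v A / mass mu A < +oo.
  by apply: lty_poweRy Vmpy; rewrite gt_eqF// subr_gt0.
have K0 : 0 < K by apply: lt_le_trans KA; rewrite mule_gt0// poweR_gt0.
have [Wy _] : wmass mu w A < +oo /\ (m^-1)%:E < +oo.
  by apply: pos_mule_lty => //; rewrite ?lte_fin ?invr_gt0// -minv -mE.
have [Vy _] : wmass mu v A < +oo /\ (m^-1)%:E < +oo.
  by apply: pos_mule_lty => //; rewrite ?lte_fin ?invr_gt0// -minv -mE.
have [W W_gt0 WE] := pos_finE W0 Wy.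
have [V V_gt0 VE] := pos_finE V0 Vy.
have [k k0 kE] := pos_finE K0 Ky.
have [s s0 sE] := pos_finE wS0 (le_lt_trans wSA Wy).
rewrite WE kE sE -!EFinM lee_fin.
apply: (@Ap_real_bound p k m n W V s kap) => //.
  by move: KA; rewrite WE VE mE kE minv -!EFinM lee_fin.
move=> t t0; rewrite -lee_fin EFinD !EFinM -nE -sE -VE.
have t'0 : (0 < t `^ (- (p - 1)^-1))%R by rewrite powR_gt0.
apply: (@le_trans _ _
  (\esum_(y in S) (t%:E * (w y * mu y)%:E) +
   \esum_(y in S) ((t `^ (- (p - 1)^-1))%:E * (v y * mu y)%:E))).
  rewrite -esumD; last 2 first.
  - by move=> y _; rewrite -EFinM lee_fin mulr_ge0 ?ltW.
  - by move=> y _; rewrite -EFinM lee_fin mulr_ge0 ?ltW.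
  apply: le_esum => y _; rewrite -!EFinM -EFinD lee_fin !mulrA -mulrDl.
  rewrite -powRM; [|exact: ltW..].
  apply: ler_peMl; first exact: ltW.
  by apply: powR_add_inverse_ge1; rewrite ?invr_gt0 ?subr_gt0 ?mulr_gt0.
apply: leeD; first by apply: esum_scale_le => // y; rewrite lee_fin ltW.
apply: (@le_trans _ _ ((t `^ (- (p - 1)^-1))%:E * wmass mu v S)).
  by apply: esum_scale_le => // y; rewrite lee_fin ltW.
rewrite lee_pmul2l ?lte_fin//.
by apply: esum_subset => // y _; rewrite lee_fin ltW.
Qed.

End WeightComparison.

(** * Mass of trapezoids *)

Section MassOfTrapezoids.
Set Implicit Arguments.
Unset Strict Implicit.
Context {R : realType} {T : choiceType} (e : rel T) (omega : set (nat -> T)).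
Context (o : T) (mu : T -> R).
Hypotheses (treeT : is_tree e) (bomega : boundary e omega).
Hypothesis flow : flow_measure e omega o mu.
Local Notation trap x h k := (trapezoid (R := R) e omega x h%:R k%:R).
Local Notation par := (parent omega).
Implicit Types (x y : T) (h k n : nat).

Lemma trapezoidP x (a b : R) y :
  trapezoid e omega x a b y <-> exists2 n, a <= n%:R < b & iter n par y = x.
Proof.
split=> [[yx ab]|[n ab nyx]].
  by exists (gdist e x y) => //; apply/(tree_le_gdistP treeT bomega).
by have [yx gE] := (tree_le_gdistP treeT bomega x y n).2 nyx; split; rewrite ?gE.
Qed.

Definition generation x n : set T := [set y | iter n par y = x].

Lemma trapezoid_bigcup x h n :
  trap x h (h + n)%N = \bigcup_(i in `I_n) generation x (h + i)%N.
Proof.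
apply/seteqP; split=> y.
  move=> /trapezoidP[m]; rewrite ler_nat ltr_nat => /andP[hm mn] ymx.
  by exists (m - h)%N; rewrite /generation /= ?subnKC// ltn_subLR.
move=> [i /= lin yix]; apply/trapezoidP; exists (h + i)%N => //.
by rewrite ler_nat ltr_nat leq_addr ltn_add2l.
Qed.

Lemma generation_trivIset x : trivIset setT (generation x).
Proof.
move=> i j _ _ [y [/= yi yj]].
by rewrite -(gdist_iter_parent treeT bomega y i) yi -yj gdist_iter_parent.
Qed.

(** The flow equation propagated n steps down: the vertices n + 1 steps below x
    split according to the successor of x through which they pass. *)
Lemma mass_generation x n : mass mu (generation x n) = (mu x)%:E.
Proof.
have mu0 y : (0 <= (mu y)%:E)%E by rewrite lee_fin ltW// flow.1.
elim: n x => [|n IH] x.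
  rewrite (_ : generation x 0 = [set x]) ?/mass ?esum_set1//.
rewrite (_ : generation x n.+1 =
  \bigcup_(z in successors (R := R) e omega o x) generation z n).
  rewrite /mass esum_disjoint_bigcup//.
    by rewrite (flow.2 x); apply: eq_esum => z _; exact: IH.
  by move=> z z' _ _ [y [/= <- <-]].
rewrite (successorsE treeT bomega); apply/seteqP; split=> y /=.
  by move=> yx; exists (iter n par y).
by move=> [z /= <- <-].
Qed.

Lemma mass_trapezoid x h k : (h <= k)%N ->
  mass mu (trap x h k) = ((k - h)%:R * mu x)%:E.
Proof.
move=> hk; rewrite -{1}(subnKC hk) trapezoid_bigcup /mass esum_disjoint_bigcup//; last 2 first.
- move=> i j _ _ /(@generation_trivIset x) ij; apply: (@addnI h); exact: ij.
- by move=> y; rewrite lee_fin ltW// flow.1.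
rewrite esum_fset ?finite_II//; last first.
  by move=> i _; apply: esum_ge0 => y _; rewrite lee_fin ltW// flow.1.
rewrite -fsbig_ord/=; under eq_bigr do rewrite [esum _ _]mass_generation.
by rewrite sumEFin sumr_const card_ord mulr_natl.
Qed.

Lemma trapezoid_subset x (a b a' b' : R) : a' <= a -> b <= b' ->
  trapezoid e omega x a b `<=` trapezoid e omega x a' b'.
Proof.
move=> a'a bb' y [yx /andP[ay yb]]; split=> //.
by rewrite (le_trans a'a ay) (lt_le_trans yb bb').
Qed.

End MassOfTrapezoids.

(** * Heights of the covering trapezoids *)

Section Heights.
Set Implicit Arguments.
Unset Strict Implicit.
Context {R : realType} (beta : R).
Hypothesis beta12 : 12 <= beta.

(** The trapezoid of heights h, k is admissible, and the one of heights h', k'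
    is a part of it with at least the fraction 1 / (14 * beta) of its mass. The
    constant is not optimal: 14 alone serves the trapezoid of heights g, 8 * g,
    and a multiple of beta the one of heights 2 * h2, ceil(h2 * beta). *)
Definition comparable_heights (h k h' k' : nat) : Prop :=
  [/\ (0 < h)%N, (h.*2 <= k)%N & k%:R <= beta * h%:R] /\
  [/\ (h <= h')%N, (h' < k')%N, (k' <= k)%N &
      k%:R - h%:R <= 14 * beta * (k'%:R - h'%:R)].

Lemma nat_ceil (a : R) : 0 < a -> exists n : nat,
  [/\ (0 < n)%N, (Num.ceil a)%:~R = n%:R :> R, a <= n%:R & n%:R < a + 1].
Proof.
move=> a0; have c0 : 0 < Num.ceil a by rewrite ceil_gt0.
exists `|Num.ceil a|%N.
have E : (Num.ceil a)%:~R = `|Num.ceil a|%N%:R :> R.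
  by rewrite natr_absz gtr0_norm.
rewrite absz_gt0 gt_eqF//; split => //; rewrite -E; first exact: ceil_ge.
by rewrite -ltrBlDr; have := ceilB1_lt a; rewrite intrB.
Qed.

Lemma beta_mul_ge (a : R) : 0 <= a -> 12 * a <= beta * a.
Proof. by move=> a0; rewrite ler_wpM2r. Qed.

(** The two trapezoids above the one of heights h, 2 * h. The inequality 1 < h
    is what makes c small enough for 4 * c <= 2 * h to hold; for h = 1 the
    envelope has nothing above. *)
Lemma top_heights (h : nat) : (1 < h)%N -> exists c a : nat,
  [/\ (Num.ceil (h%:R / beta))%:~R = c%:R :> R,
      comparable_heights c (4 * c) (2 * c) (4 * c),
      comparable_heights a (2 * h) h (2 * h),
      (a <= 2 * c)%N & (4 * c <= 2 * h)%N].
Proof.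
move=> h_gt1; have b12 := beta12.
have hR : 0 < h%:R :> R by rewrite ltr0n; lia.
have beta0 : 0 < beta by lra.
have [c [c0 -> hc ch]] := nat_ceil (divr_gt0 hR beta0).
have hR2 : 0 < 2 * h%:R :> R by lra.
have [a [a0 _ ha ah]] := nat_ceil (divr_gt0 hR2 beta0).
have c12 : (12 * c < h + 12)%N.
  rewrite -(ltr_nat R) natrM natrD.
  suff : h%:R / beta <= h%:R / 12 :> R by lra.
  by rewrite ler_pM2l// lef_pV2 ?posrE.
have a6 : (6 * a < h + 6)%N.
  rewrite -(ltr_nat R) natrM natrD.
  suff : 2 * h%:R / beta <= 2 * h%:R / 12 :> R by lra.
  by rewrite ler_pM2l// lef_pV2 ?posrE.
have ac : (a <= 2 * c)%N.
  rewrite -ltnS -(ltr_nat R) -natr1 natrM.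
  by apply: (lt_le_trans ah); rewrite lerD2r -mulrA ler_pM2l.
have b2h : 2 * h%:R <= beta * a%:R by rewrite [leRHS]mulrC -ler_pdivrMr.
have bh := beta_mul_ge (ltW hR).
have bc := beta_mul_ge (ler0n R c).
have cR : 1 <= c%:R :> R by rewrite ler1n.
have aR : 1 <= a%:R :> R by rewrite ler1n.
exists c, a; split; [by []| | |exact: ac|by clear -c12 h_gt1; lia].
  split; split; rewrite ?natrM; try lra; by clear -c0; lia.
split; split; rewrite ?natrM; try lra; by clear -a0 a6 h_gt1; lia.
Qed.

(** The two trapezoids below the one of heights h1, h2; the witness for g is half
    of h2, rounded up. *)
Lemma bottom_heights (h1 h2 : nat) : (0 < h1)%N -> (h1.*2 <= h2)%N ->
  exists g m : nat,
  [/\ h2%:R * beta <= m%:R,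
      comparable_heights g (8 * g) g h2,
      comparable_heights (2 * h2) m (2 * h2) (4 * h2),
      (h1 <= g <= h2)%N & (4 * h2 <= 8 * g)%N].
Proof.
move=> h1_gt0 h12; have b12 := beta12.
have h2R : 1 <= h2%:R :> R by rewrite ler1n; lia.
have hb0 : 0 < h2%:R * beta by rewrite mulr_gt0//; lra.
have [m [m0 _ hm mh]] := nat_ceil hb0.
have bh2 := beta_mul_ge (ler0n R h2).
have m12 : (12 * h2 <= m)%N by rewrite -(ler_nat R) natrM; lra.
have [g [g0 hg gh gh2]] : exists g,
    [/\ (0 < g)%N, (h1 <= g <= h2)%N, (h2 <= 2 * g)%N & (3 * g <= 2 * h2)%N].
  by exists (h2 - h2./2)%N; split; lia.
have gR : 3 * g%:R <= 2 * h2%:R :> R by rewrite -!natrM ler_nat.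
have gR1 : 1 <= g%:R :> R by rewrite ler1n.
have bg := beta_mul_ge (ler0n R g).
have bh2g : 12 * (h2%:R - g%:R) <= beta * (h2%:R - g%:R).
  by apply: beta_mul_ge; lra.
exists g, m; split; [exact: hm| | |exact: hg|by clear -gh; lia].
  split; split; rewrite ?natrM; try lra; by clear -g0 gh gh2 hg h12 h1_gt0; lia.
split; split; rewrite ?natrM; try lra; by clear -h1_gt0 h12 m12; lia.
Qed.

End Heights.

(** * Doubling from a trapezoid to its envelope *)

Section EnvelopeDoubling.
Set Implicit Arguments.
Unset Strict Implicit.
Context {R : realType} {T : choiceType} (e : rel T) (omega : set (nat -> T)).
Context (o : T) (mu w : T -> R) (beta p : R).
Hypotheses (beta12 : 12 <= beta) (p1 : 1 <= p).
Hypotheses (treeT : is_tree e) (bomega : boundary e omega).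
Hypothesis flow : flow_measure e omega o mu.
Hypothesis Apw : Ap e omega beta mu p w.
Local Notation trap x h k := (trapezoid (R := R) e omega x h%:R k%:R).
Local Notation K := (Ap_const e omega beta mu p w).
Local Notation wm := (wmass mu w).
Local Open Scope ereal_scope.

Let wmu_gt0 y : (0 < w y * mu y)%R.
Proof. by rewrite mulr_gt0// ?(flow.1 y)// Apw.1. Qed.

Let wmu_ge0 y : 0 <= (w y * mu y)%:E.
Proof. by rewrite lee_fin ltW. Qed.

Let wm_ge0 A : 0 <= wm A.
Proof. by apply: esum_ge0 => y _; exact: wmu_ge0. Qed.

Lemma wmass_le A B : A `<=` B -> wm A <= wm B.
Proof. by move=> AB; apply: esum_subset. Qed.

Lemma wmass_trapezoid_split x (a b c d : R) : (c <= b)%R ->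
  wm (trapezoid e omega x a d) <=
  wm (trapezoid e omega x a b) + wm (trapezoid e omega x c d).
Proof.
move=> cb; apply: le_trans (esumU_le _) => //; apply: wmass_le => y [yx].
move=> /andP[ay yd]; have [yb|yb] := ltP (gdist e x y)%:R%R b.
  by left; split=> //; rewrite ay.
by right; split=> //; rewrite yd (le_trans cb).
Qed.

Definition step_const := ((2 * (14 * beta)) `^ p)%R.

Lemma trapezoid_step x (h k h' k' : nat) : comparable_heights beta h k h' k' ->
  wm (trap x h k) <= step_const%:E * K * wm (trap x h' k').
Proof.
move=> [[h0 h2k kb] [hh' hk' kk' kap]].
have hk : (h < k)%N by lia.
have mux : (0 < mu x)%R by exact: flow.1.
apply: (Ap_comparison flow.1 Apw.1 p1 Apw.2).
- left; exists x, h, k; split=> //; split=> //.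
  rewrite ler_pdivlMr ?ltr0n// ler_pdivrMr ?ltr0n// kb andbT.
  by rewrite -natrM ler_nat mul2n.
- by apply: trapezoid_subset; rewrite ler_nat.
- by rewrite (mass_trapezoid treeT bomega flow x (ltnW hk)) ltry.
- rewrite (mass_trapezoid treeT bomega flow x (ltnW hk)) lte_fin mulr_gt0//.
  by rewrite ltr0n subn_gt0.
- rewrite (mass_trapezoid treeT bomega flow x (ltnW hk)).
  rewrite (mass_trapezoid treeT bomega flow x (ltnW hk')) -EFinM lee_fin mulrA.
  by rewrite ler_pM2r// !natrB// ltnW.
Qed.

(** The comparison property for a singleton inside itself gives this lower
    bound, which allows one to replace one comparison step by two. *)
Lemma step_ge1 : exists2 l : R, step_const%:E * K = l%:E & (1 <= l)%R.
Proof.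
have b12 := beta12.
have b14 : (1 <= 14 * beta)%R by lra.
have b28 : (0 < 2 * (14 * beta))%R by lra.
have mS : mass mu [set o] = (mu o)%:E.
  by rewrite /mass esum_set1// lee_fin ltW ?flow.1.
have wS : wm [set o] = (w o * mu o)%:E by rewrite /wmass esum_set1.
have : wm [set o] <= step_const%:E * K * wm [set o].
  apply: (Ap_comparison flow.1 Apw.1 p1 Apw.2) => //.
  - by right; exists o.
  - by rewrite mS ltry.
  - by rewrite mS lte_fin flow.1.
  - by rewrite mS -EFinM lee_fin ler_peMl// ltW// flow.1.
have c0 : (0 < step_const)%R by rewrite powR_gt0.
rewrite wS; have := Apw.2; case: K => [k| |]// _.
  by rewrite -!EFinM lee_fin ler_pMl// => kl; exists (step_const * k)%R.
by rewrite gt0_muleNy ?lte_fin// gt0_mulNye ?lte_fin.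
Qed.

Section Trapezoid.
Context (x : T) (h1 h2 : nat).
Hypotheses (h1_gt0 : (0 < h1)%N) (h12 : (h1.*2 <= h2)%N).
Local Notation L := (step_const%:E * K).
Local Notation Y := (wm (trap x h1 h2)).

Let L_ge1 : 1 <= L.
Proof. by have [l -> l1] := step_ge1; rewrite lee_fin. Qed.

Let L_ge0 : 0 <= L. Proof. exact: le_trans L_ge1. Qed.

Let Z : L * Y <= L * (L * Y).
Proof. by rewrite lee_wpmul2l ?L_ge0// lee_pemull. Qed.

Let Z_ge0 : 0 <= L * (L * Y).
Proof. by rewrite mule_ge0 ?L_ge0// mule_ge0 ?L_ge0. Qed.

Lemma wmass_top_part :
  wm (trapezoid (R := R) e omega x (Num.ceil (h1%:R / beta)%R)%:~R h1%:R)
    <= L * (L * Y) + L * (L * Y).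
Proof.
(* For h1 = 1 the lower height ceil(h1 / beta) of the envelope is also 1. *)
have [h1_le1|h1_gt1] := leqP h1 1.
  rewrite (_ : trapezoid _ _ _ _ _ = set0).
    by rewrite /wmass esum_set0 adde_ge0.
  have beta0 : (0 < beta)%R by apply: lt_le_trans beta12.
  have h1R : (0 < h1%:R :> R)%R by rewrite ltr0n.
  have [c [c0 -> _ _]] := nat_ceil (divr_gt0 h1R beta0).
  rewrite -subset0 => y [_ /andP[]]; rewrite ler_nat ltr_nat => cd dh.
  by have := leq_trans (leq_ltn_trans (leq_trans c0 cd) dh) h1_le1.
have [c [a [-> hc ha ac ch]]] := top_heights beta12 h1_gt1.
have A2 : wm (trap x a (2 * h1)) <= L * Y.
  apply: le_trans (trapezoid_step x ha) _; rewrite lee_wpmul2l ?L_ge0//.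
  by apply: wmass_le; apply: trapezoid_subset => //; rewrite ler_nat mul2n.
have A1 : wm (trap x c (4 * c)) <= L * (L * Y).
  apply: le_trans (trapezoid_step x hc) _; rewrite lee_wpmul2l ?L_ge0//.
  apply: le_trans A2; apply: wmass_le.
  by apply: trapezoid_subset; rewrite ler_nat.
apply: (@le_trans _ _ (wm (trap x c (2 * h1)))).
  by apply: wmass_le; apply: trapezoid_subset; rewrite ?ler_nat ?leq_pmull.
apply: (@le_trans _ _ (wm (trap x c (4 * c)) + wm (trap x a (2 * h1)))).
  apply: wmass_trapezoid_split; rewrite ler_nat (leq_trans ac)//.
  by rewrite leq_mul2r orbT.
by apply: leeD => //; exact: le_trans Z.
Qed.

Lemma wmass_bottom_part : wm (trapezoid e omega x h2%:R (h2%:R * beta))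
  <= L * (L * Y) + L * (L * Y).
Proof.
have [g [m [hm hg hh /andP[h1g gh2] h2g]]] := bottom_heights beta12 h1_gt0 h12.
have A3 : wm (trap x g (8 * g)) <= L * Y.
  apply: le_trans (trapezoid_step x hg) _; rewrite lee_wpmul2l ?L_ge0//.
  by apply: wmass_le; apply: trapezoid_subset => //; rewrite ler_nat.
have A4 : wm (trap x (2 * h2) m) <= L * (L * Y).
  apply: le_trans (trapezoid_step x hh) _; rewrite lee_wpmul2l ?L_ge0//.
  apply: le_trans A3; apply: wmass_le.
  by apply: trapezoid_subset; rewrite ler_nat// (leq_trans gh2)// leq_pmull.
apply: (@le_trans _ _ (wm (trap x g m))).
  by apply: wmass_le; apply: trapezoid_subset; rewrite ?ler_nat.
apply: (@le_trans _ _ (wm (trap x g (8 * g)) + wm (trap x (2 * h2) m))).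
  apply: wmass_trapezoid_split; rewrite ler_nat; apply: leq_trans h2g.
  by rewrite leq_mul2r orbT.
by apply: leeD => //; exact: le_trans Z.
Qed.

Lemma wmass_trapezoid_envelope :
  wm (trapezoid_envelope e omega beta x h1 h2) <= 5%:E * (L * (L * Y)).
Proof.
have YZ : Y <= L * (L * Y).
  have YL : Y <= L * Y by rewrite lee_pemull.
  exact: le_trans YL Z.
rewrite (_ : 5%:E * _ = (L * (L * Y) + L * (L * Y)) +
    (L * (L * Y) + (L * (L * Y) + L * (L * Y)))).
  apply: le_trans (leeD wmass_top_part (leeD YZ wmass_bottom_part)).
  apply: le_trans (@wmass_trapezoid_split _ _ h1%:R h1%:R _ _) _ => //.
  by rewrite leeD2l//; exact: wmass_trapezoid_split.
have -> : (5 = (1 + 1) + (1 + (1 + 1)) :> R)%R by ring.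
by rewrite !EFinD !ge0_muleDl ?mul1e ?adde_ge0 ?lee_fin.
Qed.

End Trapezoid.
End EnvelopeDoubling.

Theorem theorem2p7 (R : realType) (beta p : R) (hbeta : 12 <= beta) (hp : 1 <= p) :
  exists2 C : R, 0 < C &
    forall (T : choiceType) (e : rel T) (omega : set (nat -> T)) (o : T)
      (mu w : T -> R),
      is_tree e -> infinite_set [set: T] -> boundary e omega ->
      flow_measure e omega o mu ->
      Ap e omega beta mu p w ->
      forall A Aenv : set T, has_envelope e omega beta A Aenv ->
        (wmass mu w Aenv <=
         C%:E * Ap_const e omega beta mu p w ^+ 2 * wmass mu w A)%E.
Proof.
have c0 : 0 < step_const beta p by rewrite powR_gt0//; lra.
exists (5 * step_const beta p ^+ 2); first by rewrite mulr_gt0// exprn_gt0.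
move=> T e omega o mu w treeT _ bomega flow Apw A Aenv AE.
have [l lE l1] := step_ge1 hbeta hp flow Apw.
have -> : ((5 * step_const beta p ^+ 2)%:E * Ap_const e omega beta mu p w ^+ 2 *
    wmass mu w A = 5%:E * (l%:E * (l%:E * wmass mu w A)))%E.
  by rewrite -lE EFinM expr2 EFinM expe2 -!muleA; congr (_ * _)%E; rewrite muleCA !muleA.
case: AE => [x h1 h2 [h1_gt0 _ h12]|x].
  rewrite -lE; apply: (wmass_trapezoid_envelope hbeta hp treeT bomega flow Apw) => //.
  by move: h12; rewrite ler_pdivlMr ?ltr0n// -natrM ler_nat mul2n => /andP[].
have W0 : (0 <= wmass mu w [set x])%E.
  by apply: esum_ge0 => y _; rewrite lee_fin mulr_ge0// ltW// ?(flow.1 y) ?Apw.1.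
have grow (r : R) (z : \bar R) : 1 <= r -> (0 <= z)%E -> (z <= r%:E * z)%E.
  by move=> r1 z0; rewrite lee_pemull.
have lW0 : (0 <= l%:E * wmass mu w [set x])%E := le_trans W0 (grow _ _ l1 W0).
apply: le_trans (grow _ _ l1 W0) _.
apply: le_trans (grow _ _ l1 lW0) _.
by apply: (grow _ _ _ (le_trans lW0 (grow _ _ l1 lW0))); lra.
Qed.
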